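(* Let $N\ge 2$ be an integer and let $t\ge 0$ be fixed. Let $(A,d)$ be an infinite compact metric space with $\operatorname{diam}(A)<1$. Then the function $g(s):=\mathcal{E}^s_{\log^t}(A,N)$ is continuous on $[0,\infty)$.
   Context: $\operatorname{diam}(A):=\sup_{x,y\in A}d(x,y)$. An $N$-point configuration is a set $\omega_N\subset A$ of $N$ distinct points. For $s,t\ge 0$ define $$E^s_{\log^t}(\omega_N):=\sum_{\substack{x\ne y\\ x,y\in\omega_N}}\frac{1}{d(x,y)^s}\left(\log\frac{1}{d(x,y)}\right)^t$$ (sum over ordered pairs of distinct points; for $t=0$ the logarithmic factor is $1$), and $$\mathcal{E}^s_{\log^t}(A,N):=\min_{\omega_N\subset A,\ \#\omega_N=N}E^s_{\log^t}(\omega_N);$$ the minimum is attained. *)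

(* Defs.v *)
From HB Require Import structures.
From mathcomp Require Import all_boot all_order all_algebra finmap.
From mathcomp Require Import all_classical all_reals all_analysis.
Set Implicit Arguments.
Unset Strict Implicit.
Unset Printing Implicit Defensive.
Import Order.TTheory GRing.Theory Num.Theory.
Import numFieldNormedType.Exports.
Local Open Scope classical_set_scope.
Local Open Scope ring_scope.

(* Taken in the extended reals, so that unbounded sets have diameter +oo
   instead of the default value 0 of the real-valued [sup]. *)
Definition diam (R : realType) (T : metricType R) (D : set T) : \bar R :=
  ereal_sup [set (mdist p.1 p.2)%:E | p in D `*` D].

(* For t = 0 the second factor is 1, since [powR x 0 = 1] for every x. *)
Definition log_riesz_kernel (R : realType) (s t r : R) : R :=
  1 / powR r s * powR (ln (1 / r)) t.

Definition log_riesz_energy (R : realType) (T : metricType R) (s t : R)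
    (w : {fset T}) : R :=
  \sum_(x <- w) \sum_(y <- w | x != y) log_riesz_kernel s t (mdist x y).

Definition configuration_energies (R : realType) (T : metricType R)
    (s t : R) (A : set T) (N : nat) : set R :=
  [set log_riesz_energy s t w | w in
    [set w : {fset T} | [set` w] `<=` A /\ #|` w|%fset = N]].

(* The minimal N-point energy; see [min_log_riesz_energyE] for the agreement
   of this infimum with the minimum. *)
Definition min_log_riesz_energy (R : realType) (T : metricType R)
    (s t : R) (A : set T) (N : nat) : R :=
  inf (configuration_energies s t A N).

Lemma min_log_riesz_energyE (R : realType) (T : metricType R) (s t : R)
    (A : set T) (N : nat) (m : R) :
  configuration_energies s t A N m ->
  lbound (configuration_energies s t A N) m ->
  min_log_riesz_energy s t A N = m.
Proof.
move=> Em lbm; apply/eqP; rewrite eq_le; apply/andP; split.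
  by apply: ge_inf => //; exists m.
by apply: lb_le_inf => //; exists m.
Qed.

(* Main.v *)
Require Import Defs.
From HB Require Import structures.
From mathcomp Require Import all_boot all_order all_algebra finmap.
From mathcomp Require Import all_classical all_reals all_analysis.
Import Order.TTheory GRing.Theory Num.Theory.
Import numFieldNormedType.Exports.
Local Open Scope classical_set_scope.
Local Open Scope ring_scope.

(** Write [g s] for the minimal energy and [E s w] for the energy of a
configuration [w].

Upper semicontinuity holds because [g] is an infimum of the continuous
functions [s |-> E s w]: a configuration nearly optimal at [s] stays nearly
optimal at nearby exponents ([min_log_riesz_energy_near_lt]).

For lower semicontinuity, distances are at most some [delta < 1], so the kernel
grows with [s] and [g] is nondecreasing; this settles exponents [u >= s].  For
[u < s] one needs that energies cannot drop abruptly when the exponent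
decreases, uniformly in [w].  Put [ell := ln delta^-1 > 0].  The kernel at a
distance [r], with [L := ln r^-1 >= ell], is [expR (u * L) * L `^ t], and every
kernel value is at most [E u w]; so [expR (u * L) <= E u w / ell `^ t] for every
distance in [w].  Raising the exponent from [u] to [s] multiplies each term by
[expR (u * L) `^ (s / u - 1)], whence
[[
  E s w / ell `^ t <= (E u w / ell `^ t) `^ (s / u)
]]
([log_riesz_energy_powR]).  This inequality passes to the infimum and yields
[g u >= ell `^ t * (g s / ell `^ t) `^ (u / s)] ([min_log_riesz_energy_powR]),
whose right-hand side tends to [g s] as [u] tends to [s]. *)

Set Implicit Arguments.
Unset Strict Implicit.

(** * The kernel *)

(** The dependence on [s] becomes exponential, with rate [ln r^-1]. *)
Lemma log_riesz_kernelE (R : realType) (s t r : R) : 0 < r ->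
  log_riesz_kernel s t r = expR (s * ln r^-1) * ln r^-1 `^ t.
Proof.
move=> r0; rewrite /log_riesz_kernel !div1r; congr (_ * _).
by rewrite /powR gt_eqF// -expRN lnV ?posrE// mulrN.
Qed.

Lemma log_riesz_kernel_ge0 (R : realType) (s t r : R) :
  0 <= log_riesz_kernel s t r.
Proof. by rewrite mulr_ge0 ?powR_ge0// div1r invr_ge0 powR_ge0. Qed.

Lemma log_riesz_kernel_shift (R : realType) (s u t r : R) : 0 < r ->
  log_riesz_kernel u t r = log_riesz_kernel s t r * expR ((u - s) * ln r^-1).
Proof.
move=> r0; rewrite !log_riesz_kernelE// mulrAC -expRD -mulrDl.
by rewrite addrC subrK.
Qed.

Lemma log_riesz_kernel_continuous (R : realType) (t r : R) : 0 < r ->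
  continuous (fun s => log_riesz_kernel s t r).
Proof.
move=> r0 s; under eq_fun do rewrite log_riesz_kernelE//.
apply: cvgMr_tmp; apply: (cvg_comp (fun s => s * ln r^-1) expR).
  by apply: cvgMr_tmp; exact: cvg_id.
exact: continuous_expR.
Qed.

(** * The energy of a configuration *)

Section energy.
Context {R : realType} {T : metricType R}.
Implicit Types (s t u : R) (w : {fset T}).

Lemma log_riesz_energy_ge0 s t w : 0 <= log_riesz_energy s t w.
Proof.
by apply: sumr_ge0 => x _; apply: sumr_ge0 => y _; exact: log_riesz_kernel_ge0.
Qed.

Lemma le_log_riesz_energy s u t w (c : R) :
  (forall x y, x \in w -> y \in w -> x != y ->
    log_riesz_kernel u t (mdist x y) <= log_riesz_kernel s t (mdist x y) * c) ->
  log_riesz_energy u t w <= log_riesz_energy s t w * c.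
Proof.
move=> suc; rewrite /log_riesz_energy mulr_suml !big_seq.
apply: ler_sum => x xw; rewrite mulr_suml.
rewrite big_seq_cond [leRHS]big_seq_cond; apply: ler_sum => y /andP[yw xy].
exact: suc.
Qed.

Lemma log_riesz_kernel_le_energy s t w x y :
  x \in w -> y \in w -> x != y ->
  log_riesz_kernel s t (mdist x y) <= log_riesz_energy s t w.
Proof.
move=> xw yw xy; rewrite /log_riesz_energy (big_rem x)//= (big_rem y)//= xy.
rewrite -addrA lerDl addr_ge0//.
  by apply: sumr_ge0 => z _; exact: log_riesz_kernel_ge0.
by apply: sumr_ge0 => z _; apply: sumr_ge0 => z' _; exact: log_riesz_kernel_ge0.
Qed.

Lemma log_riesz_energy_continuous t w :
  continuous (fun s => log_riesz_energy s t w).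
Proof.
rewrite /log_riesz_energy; apply: continuous_big => [z|x _].
  exact: add_continuous.
apply: continuous_big => [z|y xy]; first exact: add_continuous.
by apply: log_riesz_kernel_continuous; rewrite mdist_gt0.
Qed.

(** * Energies when all distances are bounded by a constant below one *)

Section bounded_distance.
Context (delta : R).
Hypothesis delta01 : 0 < delta < 1.
Hypothesis mdist_delta : forall x y : T, mdist x y <= delta.

Local Notation ell := (ln delta^-1).

Lemma ln_inv_bound_gt0 : 0 < ell.
Proof. by case/andP: delta01 => d0 d1; rewrite ln_gt0// invf_gt1. Qed.

Lemma le_ln_inv_mdist (x y : T) : x != y -> ell <= ln (mdist x y)^-1.
Proof.
rewrite -mdist_gt0 => xy; case/andP: delta01 => d0 d1.
by rewrite ler_ln ?posrE ?invr_gt0// lef_pV2 ?posrE.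
Qed.

Lemma log_riesz_energy_nondecreasing t w :
  {homo (fun s => log_riesz_energy s t w) : s u / s <= u}.
Proof.
move=> s u su; rewrite -[leRHS]mulr1; apply: le_log_riesz_energy => x y xw yw xy.
rewrite (@log_riesz_kernel_shift _ u s)//; last by rewrite mdist_gt0.
rewrite ler_wpM2l ?log_riesz_kernel_ge0// expR_le1 mulr_le0_ge0 ?subr_le0//.
exact: le_trans (ltW ln_inv_bound_gt0) (le_ln_inv_mdist xy).
Qed.

(** A superadditivity estimate, as in [\sum_i a_i `^ p <= (\sum_i a_i) `^ p] for
[p >= 1]: since a term of the energy is at most the energy itself, the energy
at [s] bounds the ratio of each term at [u] to the same term at [s].  The
division by [ell `^ t] accounts for the logarithmic factor, whose exponent
does not change with [s]. *)
Lemma log_riesz_energy_powR s u t w : 0 <= t -> 0 < s <= u ->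
  log_riesz_energy u t w / ell `^ t <=
    (log_riesz_energy s t w / ell `^ t) `^ (u / s).
Proof.
move=> t0 /andP[s0 su].
have ell0 := ln_inv_bound_gt0.
have c0 : 0 < ell `^ t by exact: powR_gt0.
have E0 : 0 <= log_riesz_energy s t w / ell `^ t.
  by rewrite divr_ge0 ?log_riesz_energy_ge0 ?ltW.
have u0 : 0 < u by exact: lt_le_trans su.
rewrite -[leRHS]mulr_powRB1 ?divr_gt0//.
rewrite mulrAC ler_pM2r ?invr_gt0//.
apply: le_log_riesz_energy => x y xw yw xy.
have d0 : 0 < mdist x y by rewrite mdist_gt0.
rewrite (@log_riesz_kernel_shift _ s u)//.
rewrite ler_wpM2l ?log_riesz_kernel_ge0//.
have -> : (u - s) * ln (mdist x y)^-1 = (s * ln (mdist x y)^-1) * (u / s - 1).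
  by rewrite mulrAC mulrBr mulr1 [s * _]mulrC divfK ?lt0r_neq0.
rewrite expRM ge0_ler_powR ?nnegrE ?expR_ge0//.
  by rewrite subr_ge0 ler_pdivlMr// mul1r.
rewrite ler_pdivlMr//; apply: le_trans (log_riesz_kernel_le_energy _ _ xw yw xy).
rewrite log_riesz_kernelE// ler_wpM2l ?expR_ge0//.
have lL := le_ln_inv_mdist xy.
by rewrite ge0_ler_powR ?nnegrE ?(ltW ell0)// (le_trans (ltW ell0)).
Qed.

(** * The minimal energy *)

Section minimal_energy.
Context (t : R) (N : nat).
Hypothesis t_ge0 : 0 <= t.
Hypothesis T_infinite : infinite_set [set: T].

Local Notation g s := (min_log_riesz_energy s t [set: T] N).

Lemma configuration_energies_neq0 s :
  configuration_energies s t [set: T] N !=set0.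
Proof.
have [B _ NB] := infinite_set_fset N T_infinite.
set w : {fset T} := [fset x in take N (enum_fset B)]%fset.
exists (log_riesz_energy s t w), w => //; split => //.
by rewrite card_fseq undup_id ?take_uniq ?fset_uniq// size_takel.
Qed.

Lemma has_inf_configuration_energies s :
  has_inf (configuration_energies s t [set: T] N).
Proof.
split; first exact: configuration_energies_neq0.
by exists 0 => _ [w _ <-]; exact: log_riesz_energy_ge0.
Qed.

Lemma min_log_riesz_energy_le s w :
  #|` w|%fset = N -> g s <= log_riesz_energy s t w.
Proof.
by move=> wN; apply: ge_inf; [case: (has_inf_configuration_energies s)|exists w].
Qed.

Lemma le_min_log_riesz_energy s m :
  (forall w, #|` w|%fset = N -> m <= log_riesz_energy s t w) -> m <= g s.
Proof.
move=> mE; apply: lb_le_inf; first exact: configuration_energies_neq0.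
by move=> _ [w [_ wN] <-]; exact: mE.
Qed.

Lemma min_log_riesz_energy_ge0 s : 0 <= g s.
Proof.
by apply: le_min_log_riesz_energy => w _; exact: log_riesz_energy_ge0.
Qed.

Lemma min_log_riesz_energy_nondecreasing s u : s <= u -> g s <= g u.
Proof.
move=> su; apply: le_min_log_riesz_energy => w wN.
apply: le_trans (min_log_riesz_energy_le _ wN) _.
exact: log_riesz_energy_nondecreasing.
Qed.

(** The bound of [log_riesz_energy_powR] is solved for the energy at the smaller
exponent, so that the infimum over configurations can be taken on that side
alone. *)
Lemma min_log_riesz_energy_powR s u : 0 < s <= u ->
  ell `^ t * (g u / ell `^ t) `^ (s / u) <= g s.
Proof.
move=> /andP[s0 su]; have u0 : 0 < u by exact: lt_le_trans su.
have c0 : 0 < ell `^ t by rewrite powR_gt0 ?ln_inv_bound_gt0.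
have su0 : 0 <= s / u by rewrite divr_ge0 ?ltW.
apply: le_min_log_riesz_energy => w wN; rewrite mulrC -ler_pdivlMr//.
have E0 : 0 <= log_riesz_energy s t w / ell `^ t.
  by rewrite divr_ge0 ?log_riesz_energy_ge0 ?ltW.
have us1 : u / s * (s / u) = 1.
  by rewrite mulrA divfK ?divff ?lt0r_neq0.
rewrite -[leRHS]powRr1// -us1 [leRHS]powRrM ge0_ler_powR ?nnegrE ?powR_ge0//.
  by rewrite divr_ge0 ?min_log_riesz_energy_ge0// ltW.
apply: le_trans (@log_riesz_energy_powR s u t w t_ge0 _); last by rewrite s0.
by rewrite ler_pM2r ?invr_gt0// min_log_riesz_energy_le.
Qed.

(** Upper semicontinuity. *)
Lemma min_log_riesz_energy_near_lt s (e : R) : 0 < e ->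
  \forall u \near s, g u < g s + e.
Proof.
move=> e0.
have [_ [w [_ wN] <-] Ew] := inf_adherent e0 (has_inf_configuration_energies s).
near=> u; apply: le_lt_trans (min_log_riesz_energy_le u wN) _.
by near: u; apply: cvgr_lt Ew; exact: log_riesz_energy_continuous.
Unshelve. all: by end_near. Qed.

(** Lower semicontinuity on the nonnegative half-line.  The power bound needs
positive exponents, but at [s = 0] the half-line leaves only exponents to the
right of [s], where monotonicity suffices. *)
Lemma min_log_riesz_energy_near_gt s (e : R) : 0 <= s -> 0 < e ->
  \forall u \near s, 0 <= u -> g s - e < g u.
Proof.
move=> s0 e0.
have g_ge u : s <= u -> g s - e < g u.
  move=> su; apply: lt_le_trans (min_log_riesz_energy_nondecreasing su).
  by rewrite ltrBlDr ltrDl.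
move: s0; rewrite le_eqVlt => /predU1P[s0|s0].
  by near=> u => u0; apply: g_ge; rewrite -s0.
have c0 : 0 < ell `^ t by rewrite powR_gt0 ?ln_inv_bound_gt0.
(* A power is continuous in its exponent only over a positive base, so the
   value [g s = 0], which occurs when [N <= 1], is set apart. *)
have := min_log_riesz_energy_ge0 s; rewrite le_eqVlt => /predU1P[gs0|gs0].
  near=> u => u0; rewrite -gs0 sub0r (@lt_le_trans _ _ 0) ?oppr_lt0//.
  exact: min_log_riesz_energy_ge0.
have lower_cvg : ell `^ t * (g s / ell `^ t) `^ (u / s) @[u --> s] --> g s.
  have a0 : 0 < g s / ell `^ t by rewrite divr_gt0.
  have {2}-> : g s = ell `^ t * (g s / ell `^ t) `^ (s / s).
    by rewrite divff ?lt0r_neq0// powRr1 ?(ltW a0)// mulrC divfK ?lt0r_neq0.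
  have powRE v : (g s / ell `^ t) `^ v = expR (v * ln (g s / ell `^ t)).
    by rewrite [LHS]/powR (gt_eqF a0).
  rewrite powRE; under eq_fun do rewrite powRE.
  apply: cvgMl_tmp.
  apply: (cvg_comp (fun u => u / s * ln (g s / ell `^ t)) expR).
    by apply: cvgMr_tmp; apply: cvgMr_tmp; exact: cvg_id.
  exact: continuous_expR.
near=> u => u0; have [/g_ge//|us] := leP s u.
have us0 : 0 < u <= s.
  by rewrite (ltW us) andbT; near: u; exact: lt_nbhsr.
apply: (lt_le_trans _ (min_log_riesz_energy_powR us0)).
by near: u; apply: (cvgr_gt (g s)) => //; rewrite ltrBlDr ltrDl.
Unshelve. all: by end_near. Qed.

End minimal_energy.
End bounded_distance.
End energy.

Unset Implicit Arguments.
Set Strict Implicit.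

(** * Continuity of the minimal energy *)

Theorem theorem2p2 (R : realType) (N : nat) (hN : (2 <= N)%N)
    (t : R) (ht : 0 <= t) (A : metricType R)
    (A_infinite : infinite_set [set: A]) (A_compact : compact [set: A])
    (A_diam : (diam [set: A] < 1%:E)%E) :
  {within `[0, +oo[, continuous
    (fun s : R => min_log_riesz_energy s t [set: A] N)}.
Proof.
have [delta delta01 mdist_delta] : exists2 delta : R,
    0 < delta < 1 & forall x y : A, mdist x y <= delta.
  have dist_le (x y : A) : ((mdist x y)%:E <= diam [set: A])%E.
    by apply: ereal_sup_ubound; exists (x, y).
  move: A_diam dist_le; case: (diam _) => [d|//|_ dist_le].
    (* The maximum with [2^-1] keeps the bound positive. *)
    rewrite lte_fin => d1 dist_le; exists (Order.max d 2^-1).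
      by rewrite lt_max invr_gt0 ltr0n orbT gt_max d1 invf_lt1// ltr1n.
    by move=> x y; rewrite le_max -lee_fin dist_le.
  (* A diameter equal to [-oo] is contradicted by any pair of points. *)
  exists 2^-1 => [|x y]; last by have := dist_le x y.
  by rewrite invr_gt0 invf_lt1// ltr1n ltr0n.
apply/subspace_continuousP => s; rewrite /= in_itv/= andbT => s0.
apply/cvgrPdist_lt => e e0; rewrite near_withinE.
have g_lt := min_log_riesz_energy_near_lt t N A_infinite s e0.
have g_gt := min_log_riesz_energy_near_gt delta01 mdist_delta N ht A_infinite s0 e0.
apply: filterS2 g_lt g_gt => u lt_u gt_u.
by rewrite /= in_itv/= andbT => /gt_u {}gt_u; rewrite ltr_distlC gt_u lt_u.
Qed.
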